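(* The following assertions are equivalent: (1) $S$ is $Q$-symmetric, i.e. $S(t)Q=QS^*(t)$ for all $t\ge0$; (2) $H$ is $S$-invariant and $S_H$ is a selfadjoint semigroup on $H$; (3) $H$ is $S$-invariant and $S_H$ is a selfadjoint $C_0$-semigroup on $H$.
   Context: $E$ is a real Banach space with dual $E^*$; $S=\{S(t)\}_{t\ge0}$ is a $C_0$-semigroup of bounded linear operators on $E$ with adjoint operators $S^*(t)$ on $E^*$. $H$ is a real Hilbert space with a continuous injective linear map $i:H\to E$; $H$ is identified with its image in $E$, and $Q:=i\circ i^*\in\mathcal L(E^*,E)$ ($H$ being identified with its dual). $H$ is $S$-invariant if $S(t)H\subseteq H$ for all $t\ge0$; in that case $S_H(t)$ denotes the restriction of $S(t)$ to $H$ (a bounded operator on $H$ by the closed graph theorem) and $S_H=\{S_H(t)\}_{t\ge0}$. The semigroup $S_H$ is selfadjoint if each $S_H(t)$ is selfadjoint on $H$. *)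

(* Defs.v *)
From HB Require Import structures.
From mathcomp Require Export all_boot all_order all_algebra.
From mathcomp Require Export all_classical all_reals all_analysis.
From mathcomp Require Import ring lra.
Export Order.TTheory GRing.Theory Num.Theory.
Export numFieldNormedType.Exports.

Set Implicit Arguments.
Unset Strict Implicit.
Unset Printing Implicit Defensive.

#[global] Open Scope classical_set_scope.
#[global] Open Scope ring_scope.

Section Operators.
Variable R : realType.

Definition bounded_linear (V W : normedModType R) (f : V -> W) : Prop :=
  linear f /\ continuous f.

Definition dual_space (V : normedModType R) : set (V -> R^o) :=
  [set f | bounded_linear f].

Definition adjoint (V W : normedModType R) (f : V -> W) (phi : W -> R^o) :
  V -> R^o := phi \o f.

(* A one-parameter family is indexed by all of R, but only its values at
   t >= 0 are ever constrained or used. *)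
Definition C0_semigroup (V : normedModType R) (S : R -> V -> V) : Prop :=
  [/\ forall t, 0 <= t -> bounded_linear (S t),
      forall x, S 0 x = x,
      forall s t, 0 <= s -> 0 <= t -> forall x, S (s + t) x = S s (S t x) &
      forall x, S t x @[t --> 0^'+] --> x].

End Operators.

Section Hilbert.
Variables (R : realType) (H : completeNormedModType R).
Variable ip : {dot H for idfun}.

(* The identification of the dual of H with H; see rieszP below. *)
Definition riesz (phi : H -> R^o) : H :=
  xget 0 [set h | forall g, ip h g = phi g].

(* Boundedness is part of the notion: these are elements of L(H) that equal
   their Hilbert space adjoint. *)
Definition selfadjoint (T : H -> H) : Prop :=
  bounded_linear T /\ forall h g, ip (T h) g = ip h (T g).

Definition selfadjoint_semigroup (T : R -> H -> H) : Prop :=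
  forall t, 0 <= t -> selfadjoint (T t).

Variables (E : completeNormedModType R) (i : H -> E).

(* Q = i o i^*, where i^* maps into H through the Riesz identification. *)
Definition Qop (phi : E -> R^o) : E := i (riesz (adjoint i phi)).

Definition Q_symmetric (S : R -> E -> E) : Prop :=
  forall t, 0 <= t -> forall phi, dual_space phi ->
    S t (Qop phi) = Qop (adjoint (S t) phi).

Definition semigroup_invariant (S : R -> E -> E) : Prop :=
  forall t, 0 <= t -> S t @` range i `<=` range i.

(* S_H(t), transported to H along the injection i: the unique g with
   i g = S t (i h), see restrictionP below.  By the closed graph theorem it is
   automatically a bounded operator, so the boundedness clauses in selfadjoint
   and C0_semigroup add nothing to the invariance of H. *)
Definition restriction (S : R -> E -> E) (t : R) (h : H) : H :=
  xget 0 [set g | i g = S t (i h)].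

Lemma restrictionP (S : R -> E -> E) (t : R) (h : H) :
  semigroup_invariant S -> 0 <= t -> i (restriction S t h) = S t (i h).
Proof.
move=> SH t0; have [|g _ ig] := SH t t0 (S t (i h)); first by exists (i h).
exact: (@xgetI _ 0 [set g | i g = S t (i h)] g ig).
Qed.

End Hilbert.

Section RieszRepresentation.
Variables (R : realType) (H : completeNormedModType R).
Variable ip : {dot H for idfun}.
Hypothesis ip_norm : forall h, ip h h = `|h| ^+ 2.

Let ipC u v : ip u v = ip v u.
Proof. by rewrite hermC/= expr0 mul1r. Qed.

Let ipZ u v (t : R) : ip u (t *: v) = t * ip u v.
Proof. by rewrite linearZ_LR. Qed.

Let normDZ u v (t : R) :
  `|u + t *: v| ^+ 2 = `|u| ^+ 2 + 2 * t * ip u v + t ^+ 2 * `|v| ^+ 2.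
Proof.
have ipD x y z : ip x (y + z) = ip x y + ip x z by rewrite linearD.
by rewrite -!ip_norm ipD ipZ !(ipC (u + _)) !ipD !ipZ (ipC v u); ring.
Qed.

Variable phi : H -> R^o.
Hypothesis dphi : dual_space phi.

Let phiL : {linear H -> R^o} :=
  HB.pack phi (GRing.isLinear.Build _ _ _ _ phi dphi.1).

Let phiD u v (t : R) : phi (u + t *: v) = phi u + t * phi v.
Proof. by rewrite addrC dphi.1 addrC. Qed.

Let J (h : H) : R := `|h| ^+ 2 - 2 * phi h.

Let J_lb : exists m, forall h, m <= J h.
Proof.
have /linear_boundedP/pinfty_ex_gt0[M M0 phiM] : bounded_near phiL (nbhs 0).
  apply/(linear_bounded_continuous phiL); exact: dphi.2.
exists (- M ^+ 2) => h; have := phiM h; rewrite /= /J => {}phiM.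
have /ler_normlP[_ le] := phiM.
have := sqr_ge0 (`|h| - M); rewrite sqrrB; nra.
Qed.

Let J_mid m a b : (forall h, m <= J h) ->
  `|a - b| ^+ 2 <= 2 * (J a - m) + 2 * (J b - m).
Proof.
move=> /(_ (2^-1 *: a + 2^-1 *: b)).
have -> : a - b = a + (-1) *: b by rewrite scaleN1r.
have phiZ : phi (2^-1 *: a) = 2^-1 * phi a by exact: (linearZ_LR phiL).
rewrite /J phiD phiZ !normDZ (ipC (_ *: _)) ipZ (ipC b) normrZ exprMn.
by rewrite ger0_norm ?invr_ge0//; lra.
Qed.

Let J_cont : continuous J.
Proof.
move=> h; apply: cvgB; last by apply: cvgMl_tmp; exact: dphi.2.
by rewrite expr2; under eq_fun do rewrite expr2; apply: cvgM; exact: norm_continuous.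
Qed.

Let J_min : exists h, forall g, J h <= J g.
Proof.
have [m0 m0J] := J_lb.
have rJ : has_inf (range J) by split; [exists (J 0), 0|exists m0 => _ [h _ <-]].
pose m := inf (range J).
have mJ h : m <= J h by apply: ge_inf; [exact: rJ.2|exists h].
have /choice[u uJ] n : exists h, J h < m + n.+1%:R^-1.
  have [] := @inf_adherent _ (range J) n.+1%:R^-1 _ rJ; first by [].
  by move=> _ [h _ <-]; exists h.
have cu : cvg (u @ \oo).
  apply: cauchy_cvg; apply: cauchy_exP => e e0.
  have e2 : 0 < e ^+ 2 / 4 by rewrite divr_gt0// exprn_gt0.
  have [N _ /(_ N (leqnn N))/= NE] := near_infty_natSinv_lt (PosNum e2).
  exists (u N), N => // n/= Nn; rewrite -ball_normE /ball_/=.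
  rewrite -(@ltr_pXn2r _ 2)// ?nnegrE ?(ltW e0)//.
  have nN : n.+1%:R^-1 <= N.+1%:R^-1 :> R by rewrite lef_pV2 ?posrE// ler_nat.
  have := J_mid (u N) (u n) mJ; have := uJ N; have := uJ n.
  by move: nN NE; move: (n.+1%:R^-1) (N.+1%:R^-1) => x y; lra.
have /cvg_ex[h uh] := cu.
exists h => g; apply: (@le_trans _ _ m) => //.
apply/ler_addgt0Pr => e e0.
have Juh : J (u n) @[n --> \oo] --> J h by apply: continuous_cvg => //; exact: J_cont.
rewrite -(cvg_lim _ Juh)//; apply: limr_le; first by apply/cvg_ex; exists (J h).
have [N _ NE] := near_infty_natSinv_lt (PosNum e0).
by exists N => // n /NE/= ne; apply/ltW/(lt_trans (uJ n)); rewrite ltrD2l.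
Qed.

Lemma rieszP g : ip (riesz ip phi) g = phi g.
Proof.
move: g; apply: (@xgetPex _ 0 [set h | forall g, ip h g = phi g]).
have [h hJ] := J_min; exists h => g /=.
apply/eqP; rewrite -subr_eq0; set d := ip h g - phi g.
pose c := (`|g| ^+ 2 + 1)^-1.
have c0 : 0 < c by rewrite invr_gt0; have := sqr_ge0 `|g|; lra.
have cE : c * `|g| ^+ 2 = 1 - c.
  have : c * (`|g| ^+ 2 + 1) = 1.
    by rewrite mulVf//; have := sqr_ge0 `|g|; apply: contra_leN; lra.
  lra.
have := hJ (h + (- (d * c)) *: g); rewrite /J normDZ phiD => le.
have {}le : 0 <= - (2 * c * d ^+ 2) + d ^+ 2 * c * (1 - c).
  rewrite -cE; move: le; rewrite /d; nra.
have : c * d ^+ 2 <= 0 by nra.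
by rewrite pmulr_rle0// => d2; rewrite -sqrf_eq0 eq_le d2 sqr_ge0.
Qed.

End RieszRepresentation.

(* Main.v *)
From HB Require Import structures.
Require Import Defs.
From mathcomp Require Import ring lra.

Set Implicit Arguments.
Unset Strict Implicit.
Unset Printing Implicit Defensive.

(** Write [istar] for the adjoint of the embedding [i], so that [Q] is
    [i \o istar].

    If the restriction [T] of [S] to [H] is selfadjoint, then testing against
    [h] in [H] shows that [T t (istar phi) = istar (phi \o S t)], and applying
    [i] gives Q-symmetry ([selfadjoint_Q_symmetric]).

    Conversely, let [A = S t] satisfy [A Q = Q A^*]. The argument of Lax on
    symmetrizable operators ([istar_adjoint_le]) compares norms on [H] with
    those on [E]: the even moments [phi (A^(2n) (Q phi))] are squares of norms
    in [H], and their log-convexity forces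
    [|istar (A^* phi)| <= M |istar phi|] as soon as [M] bounds [A] on
    [E]. A vector [x] of [E] lies in the range of [i] when
    [phi x <= c |istar phi|] for every [phi] ([range_criterion]); so [A] maps
    [H] into itself and its restriction is bounded by [M]
    ([symmetrizable_range]). The symmetry [ip (T h) g = ip h (T g)] is immediate
    for [g] in the range of [istar], which is total because [i] is injective;
    hence the restriction is selfadjoint.

    As the bound on the restriction is the one on [E], the local boundedness of
    [S] near 0, a consequence of the uniform boundedness principle, passes to
    [H]. With the density of the range of [istar] it gives weak continuity at 0,
    which for a selfadjoint semigroup implies strong continuity
    ([restriction_strongly_continuous]).

    Separation of points, density and the range criterion all need functionals
    with prescribed lower bounds. They come from the Mazur-Orlicz theorem
    ([mazur_orlicz]), proved from Zorn's lemma and from the linearity of minimal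
    sublinear functionals. *)

(** * The Mazur-Orlicz theorem *)

Section MazurOrlicz.
Variables (R : realType) (V : lmodType R).
Implicit Types (p q : V -> R) (u v : V).

(** Positive homogeneity is only asked as an inequality: applied to [t^-1] it
    gives the equality, and infima of functionals inherit it more easily. *)
Definition sublinear q : Prop :=
  (forall u v, q (u + v) <= q u + q v) /\
  (forall t v, 0 < t -> q (t *: v) <= t * q v).

(** A pair [(v, r)] of a cone stands for the constraint [r <= f v] on the
    linear functional [f] to be found. *)
Definition convex_cone (C : set (V * R)) : Prop :=
  [/\ C (0, 0),
      forall a b, C a -> C b -> C (a.1 + b.1, a.2 + b.2) &
      forall t a, 0 < t -> C a -> C (t *: a.1, t * a.2)].

Lemma convex_cone_ray (v : V) (r : R) :
  convex_cone [set a | exists2 t, 0 <= t & a = (t *: v, t * r)].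
Proof.
split.
- by exists 0; rewrite // scale0r mul0r.
- move=> _ _ [s s0 ->] [t t0 ->]; exists (s + t); rewrite ?addr_ge0//=.
  by rewrite scalerDl mulrDl.
- move=> s _ s0 [t t0 ->]; exists (s * t); first by rewrite mulr_ge0// ltW.
  by rewrite /= scalerA mulrA.
Qed.

Lemma sublinear0 q : sublinear q -> q 0 = 0.
Proof.
move=> [qD qZ]; have := qD 0 0; have := @qZ 2^-1 0.
by rewrite invr_gt0 ltr0n scaler0 addr0 => /(_ isT); lra.
Qed.

Lemma sublinear_ge q v : sublinear q -> - q (- v) <= q v.
Proof. by move=> sq; have := sq.1 v (- v); rewrite subrr sublinear0//; lra. Qed.

(** Both infima needed below, over a chain of functionals and over a cone of
    constraints, are taken over families that are directed in this sense. *)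
Lemma inf_sublinear (I : Type) (D : set I) (F : I -> V -> R) :
    D !=set0 -> (forall v, has_lbound [set F i v | i in D]) ->
    (forall i j u v, D i -> D j ->
      exists2 k, D k & F k (u + v) <= F i u + F j v) ->
    (forall i t v, D i -> 0 < t -> exists2 k, D k & F k (t *: v) <= t * F i v) ->
  sublinear (fun v => inf [set F i v | i in D]).
Proof.
move=> [i0 Di0] Flb FD FZ.
have lbF k v : D k -> inf [set F i v | i in D] <= F k v.
  by move=> Dk; apply: ge_inf => //; exists k.
split=> [u v|t v t0].
- rewrite -lerBlDr; apply: lb_le_inf; first by exists (F i0 u), i0.
  move=> _ [i Di <-]; rewrite lerBlDr -lerBlDl.
  apply: lb_le_inf; first by exists (F i0 v), i0.
  move=> _ [j Dj <-]; rewrite lerBlDl.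
  by have [k Dk /(le_trans (lbF _ _ Dk))] := FD i j u v Di Dj.
- rewrite -ler_pdivrMl//; apply: lb_le_inf; first by exists (F i0 v), i0.
  move=> _ [i Di <-]; rewrite ler_pdivrMl//.
  by have [k Dk /(le_trans (lbF _ _ Dk))] := FZ i t v Di t0.
Qed.

(** Zorn's lemma: the pointwise infimum of a chain is a lower bound of it. It
    is finite because every sublinear [s <= p] satisfies
    [s v >= - s (- v) >= - p (- v)]. *)
Lemma minimal_sublinear p : sublinear p ->
  exists q, [/\ sublinear q, forall v, q v <= p v &
    forall q', sublinear q' -> (forall v, q' v <= q v) -> forall v, q v <= q' v].
Proof.
move=> sp; pose T := {q | sublinear q /\ forall v, q v <= p v}.
pose below (s t : T) := `[< forall v, sval t v <= sval s v >].
pose mk q (sq : sublinear q) (qp : forall v, q v <= p v) : T :=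
  exist _ q (conj sq qp).
have [||A Atot|[q [sq qp] qmin]] := @ZL_preorder T (mk p sp (fun=> lexx _)) below.
- by move=> t; apply/asboolP.
- move=> r s t /asboolP rs /asboolP st; apply/asboolP => v.
  exact: le_trans (rs v).
- have [->|/set0P[s0 As0]] := eqVneq A set0.
    by exists (mk p sp (fun=> lexx _)).
  have Alb v : has_lbound [set sval s v | s in A].
    exists (- p (- v)) => _ [[s [ss sp']] _ <-] /=.
    by rewrite (le_trans _ (sublinear_ge _ ss))// lerN2.
  have sA : sublinear (fun v => inf [set sval s v | s in A]).
    apply: inf_sublinear => //; first by exists s0.
    - move=> r s u v Ar As.
      have [/asboolP rs|/asboolP sr] := Atot _ _ Ar As; [exists s|exists r] => //.
        by apply: le_trans ((svalP s).1.1 _ _) _; rewrite lerD2r.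
      by apply: le_trans ((svalP r).1.1 _ _) _; rewrite lerD2l.
    - by move=> s t v As t0; exists s => //; apply: (svalP s).1.2.
  have Ap v : inf [set sval s v | s in A] <= p v.
    by apply: le_trans ((svalP s0).2 v); apply: ge_inf => //; exists s0.
  exists (mk _ sA Ap) => s As; apply/asboolP => v /=.
  by apply: ge_inf => //; exists s.
exists q; split=> // q' sq' q'q v.
have q'p w : q' w <= p w by apply: le_trans (qp w).
have /qmin/asboolP : below (mk q sq qp) (mk q' sq' q'p).
  by apply/asboolP.
exact.
Qed.

(** The witness is [q' v = inf (q (v + k) - r)] over the [(k, r)] in [C]. It is
    finite because [q (v + k) - r >= q (v + k) - q k >= - q (- v)], and taking
    the constraint [(k, r)] itself in the infimum at [v = - k] gives [- r]. *)
Lemma cone_sublinear q (C : set (V * R)) : sublinear q -> convex_cone C ->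
    (forall a, C a -> a.2 <= q a.1) ->
  exists q', [/\ sublinear q', forall v, q' v <= q v &
    forall a, C a -> q' (- a.1) <= - a.2].
Proof.
move=> sq [C0 CD CZ] Cq; pose F (a : V * R) v := q (v + a.1) - a.2.
have Flb v : has_lbound [set F a v | a in C].
  exists (- q (- v)) => _ [a Ca <-]; rewrite /F.
  have := sq.1 (v + a.1) (- v); rewrite addrAC subrr add0r.
  by have := Cq a Ca; lra.
exists (fun v => inf [set F a v | a in C]); split.
- apply: inf_sublinear => //; first by exists (0, 0).
  + move=> a b u v Ca Cb; exists (a.1 + b.1, a.2 + b.2); first exact: CD.
    by rewrite /F /= addrACA; have := sq.1 (u + a.1) (v + b.1); lra.
  + move=> a t v Ca t0; exists (t *: a.1, t * a.2); first exact: CZ.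
    by rewrite /F /= -scalerDr; have := sq.2 t (v + a.1) t0; lra.
- move=> v; apply: ge_inf => //; exists (0, 0) => //.
  by rewrite /F /= addr0 subr0.
- move=> a Ca; apply: ge_inf => //; exists a => //.
  by rewrite /F addNr sublinear0// sub0r.
Qed.

(** The half-line of constraints [(t v, t q v)], [0 <= t], lowers [q] to a [q']
    with [q' (- v) <= - q v]; by minimality [q' = q], so that [q] is odd, and an
    odd sublinear functional is linear. *)
Lemma minimal_sublinear_linear q : sublinear q ->
    (forall q', sublinear q' -> (forall v, q' v <= q v) ->
      forall v, q v <= q' v) ->
  linear (q : V -> R^o).
Proof.
move=> sq qmin.
have qN v : q (- v) = - q v.
  pose C := [set a : V * R | exists2 t, 0 <= t & a = (t *: v, t * q v)].
  have [|||q' [sq' q'q /(_ (v, q v)) q'v]] := @cone_sublinear q C.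
  - exact: sq.
  - exact: convex_cone_ray.
  - move=> _ [t t0 ->] /=; have [->|tn0] := eqVneq t 0.
      by rewrite mul0r scale0r sublinear0.
    have {}t0 : 0 < t by rewrite lt_def tn0.
    have := sq.2 t^-1 (t *: v); rewrite invr_gt0 scalerA mulVf// scale1r.
    by move=> /(_ t0); rewrite ler_pdivlMl.
  have /q'v/= : C (v, q v) by exists 1; rewrite // scale1r mul1r.
  have := qmin _ sq' q'q (- v); have := sublinear_ge v sq; lra.
have qD u v : q (u + v) = q u + q v.
  apply/le_anti; rewrite sq.1/=.
  by have := sq.1 (u + v) (- v); rewrite addrK qN; lra.
have qZp t v : 0 < t -> q (t *: v) = t * q v.
  move=> t0; apply/le_anti; rewrite sq.2//= -ler_pdivlMl//.
  by rewrite -{1}(scalerK (lt0r_neq0 t0) v) sq.2// invr_gt0.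
move=> t u v; rewrite qD; congr (_ + _).
change (q (t *: u) = t * q u).
have [t0|t0|->] := ltgtP t 0.
- rewrite -[t]opprK scaleNr qN qZp ?oppr_gt0//; ring.
- exact: qZp.
- by rewrite scale0r mul0r sublinear0.
Qed.

(** The Mazur-Orlicz form of the Hahn-Banach theorem. Its constraint cone takes
    care at once of separation, of density and of extension from a subspace. *)
Theorem mazur_orlicz q (C : set (V * R)) : sublinear q -> convex_cone C ->
    (forall a, C a -> a.2 <= q a.1) ->
  exists f : V -> R^o, [/\ linear f, forall v, f v <= q v &
    forall a, C a -> a.2 <= f a.1].
Proof.
move=> sq cC Cq; have [q' [sq' q'q q'C]] := cone_sublinear sq cC Cq.
have [f [sf fq' fmin]] := minimal_sublinear sq'.
exists f; split.
- exact: minimal_sublinear_linear.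
- by move=> v; apply: le_trans (q'q v).
- move=> a /q'C; have := fq' (- a.1); have := sublinear_ge a.1 sf; lra.
Qed.

End MazurOrlicz.

(** * Bounded operators and dual spaces *)

Lemma bounded_linearP (R : realType) (V W : normedModType R) (f : V -> W) :
  bounded_linear f <->
  linear f /\ exists2 M, 0 < M & forall x, `|f x| <= M * `|x|.
Proof.
split=> -[lf].
- pose F : {linear V -> W} := HB.pack f (GRing.isLinear.Build _ _ _ _ f lf).
  move=> cf; split=> //.
  have /linear_boundedP/pinfty_ex_gt0[M M0 fM] : bounded_near F (nbhs 0).
    exact/(linear_bounded_continuous F).
  by exists M.
- pose F : {linear V -> W} := HB.pack f (GRing.isLinear.Build _ _ _ _ f lf).
  move=> [M M0 fM]; split=> //; apply/(linear_bounded_continuous F).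
  apply/linear_boundedP; exists M; split; first exact: gtr0_real.
  by move=> N MN x; rewrite (le_trans (fM x))// ler_wpM2r// ltW.
Qed.

Section Dual.
Variables (R : realType) (V : normedModType R).
Implicit Types (phi psi : V -> R^o).

Lemma dual_spaceN phi : dual_space phi -> dual_space (\- phi).
Proof.
move=> /bounded_linearP[lf [M M0 fM]]; apply/bounded_linearP; split.
  by move=> a u v /=; rewrite lf opprD scalerN.
by exists M => // x; rewrite /= normrN.
Qed.

Lemma dual_space_comb (a : R) phi psi : dual_space phi -> dual_space psi ->
  dual_space (fun x => a *: phi x + psi x).
Proof.
move=> [lf cf] [lg cg]; split.
  by move=> b u v /=; rewrite lf lg !scalerDr !scalerA mulrC addrACA.
by move=> x; apply: cvgD; [apply: cvgZr; exact: cf|exact: cg].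
Qed.

Lemma dual_space0 : dual_space (fun _ : V => 0 : R^o).
Proof. by split=> [a u v|x]; [rewrite scaler0 addr0|exact: cvg_cst]. Qed.

Lemma dual_space_comp (W : normedModType R) (f : W -> V) phi :
  bounded_linear f -> dual_space phi -> dual_space (adjoint f phi).
Proof.
move=> [lf cf] [lg cg]; split; first by move=> a u v; rewrite /adjoint/= lf lg.
by move=> x; apply: continuous_comp; [exact: cf|exact: cg].
Qed.

Lemma sublinear_norm (M : R) : 0 <= M -> sublinear (fun v : V => M * `|v|).
Proof.
move=> M0; split=> [u v|t v t0]; first by rewrite -mulrDr ler_wpM2l// ler_normD.
by rewrite normrZ gtr0_norm// mulrCA.
Qed.

Lemma dominated_dual_space (M : R) phi :
  linear phi -> (forall v, phi v <= M * `|v|) -> dual_space phi.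
Proof.
move=> lf fM; apply/bounded_linearP; split=> //; exists (`|M| + 1).
  by rewrite ltr_pwDr.
pose F : {linear V -> R^o} := HB.pack phi (GRing.isLinear.Build _ _ _ _ phi lf).
move=> v; have fN : phi (- v) = - phi v := raddfN F v.
have := fM (- v); have := fM v; rewrite fN normrN.
have := ler_norm M; have := normr_ge0 v.
rewrite ler_norml; nra.
Qed.

(** If every [phi x] is nonnegative then, replacing [phi] by [- phi], every
    [phi x] is zero, whereas the half-line of constraints [(t x, t |x|)] yields a
    [phi] with [phi x >= |x|]. *)
Lemma dual_separates (x : V) :
  (forall phi, dual_space phi -> 0 <= phi x) -> x = 0.
Proof.
move=> phi0; apply/eqP; rewrite -normr_le0.
pose C := [set a : V * R | exists2 t, 0 <= t & a = (t *: x, t * `|x|)].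
have [|||f [lf f1 /(_ (x, `|x|)) fx]] :=
  @mazur_orlicz _ _ (fun v : V => 1 * `|v|) C.
- exact: sublinear_norm.
- exact: convex_cone_ray.
- by move=> _ [t t0 ->] /=; rewrite mul1r normrZ ger0_norm.
have df := dominated_dual_space lf f1.
have /= := phi0 _ (dual_spaceN df).
have : C (x, `|x|) by exists 1; rewrite // scale1r mul1r.
by move=> /fx/=; lra.
Qed.

End Dual.

(** * The adjoint of an embedded Hilbert space *)

Section Embedding.
Variables (R : realType) (E H : completeNormedModType R).
Variable ip : {dot H for idfun}.
Hypothesis ip_norm : forall h : H, ip h h = `|h| ^+ 2.
Variable i : {linear H -> E}.
Hypotheses (i_cont : continuous i) (i_inj : injective i).
Implicit Types (phi psi : E -> R^o) (h g : H).


Lemma ip_sym h g : ip h g = ip g h.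
Proof. by rewrite hermC/= expr0 mul1r. Qed.

Let ipDr h u v : ip h (u + v) = ip h u + ip h v.
Proof. by rewrite linearD. Qed.

Let ipZr h t v : ip h (t *: v) = t * ip h v.
Proof. by rewrite linearZ_LR. Qed.

Let ipNr h v : ip h (- v) = - ip h v.
Proof. by rewrite -scaleN1r ipZr mulN1r. Qed.

Let ipDl h u v : ip (u + v) h = ip u h + ip v h.
Proof. by rewrite !(ip_sym _ h) ipDr. Qed.

Let ipZl h t v : ip (t *: v) h = t * ip v h.
Proof. by rewrite !(ip_sym _ h) ipZr. Qed.

Let ipNl h v : ip (- v) h = - ip v h.
Proof. by rewrite !(ip_sym _ h) ipNr. Qed.

Let ipE := (ipDr, ipDl, ipNr, ipNl, ipZr, ipZl).

Lemma ip_inj u v : (forall h, ip u h = ip v h) -> u = v.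
Proof.
move=> uv; apply/eqP; rewrite -subr_eq0 -normr_eq0 -sqrf_eq0 -ip_norm.
by rewrite ipDl ipNl uv subrr.
Qed.

Lemma ip_le_norm h g : ip h g <= `|h| * `|g|.
Proof.
have [->|h0] := eqVneq h 0.
  by rewrite -(scale0r g) ipZl scale0r normr0 !mul0r.
have [->|g0] := eqVneq g 0.
  by rewrite -(scale0r h) ipZr scale0r normr0 mulr0 mul0r.
have hg0 : 0 < `|h| * `|g| by rewrite mulr_gt0 ?normr_gt0.
(* The square of this norm is [2 |h| |g| (|h| |g| - ip h g)]. *)
have := sqr_ge0 `|(`|g| *: h - `|h| *: g)|.
rewrite -ip_norm !ipE !ip_norm (ip_sym g h) => le.
rewrite -subr_ge0 -(pmulr_rge0 _ hg0); move: le; lra.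
Qed.

Lemma ip_abs_norm h g : `|ip h g| <= `|h| * `|g|.
Proof.
by rewrite ler_norml ip_le_norm andbT lerNl -ipNl -(normrN h) ip_le_norm.
Qed.

Lemma dual_space_ip h : dual_space (ip h : H -> R^o).
Proof.
apply/bounded_linearP; split; first by move=> a u v; rewrite !ipE.
exists (`|h| + 1); first by rewrite ltr_pwDr.
by move=> g; rewrite (le_trans (ip_abs_norm _ _))// ler_wpM2r// lerDl.
Qed.

Lemma bounded_linear_embedding : bounded_linear i.
Proof. by split=> // a u v; rewrite linearP. Qed.

(** The adjoint of the embedding, with [H] identified with its dual, so that
    [Qop ip i] is [i \o istar]. *)
Definition istar phi : H := riesz ip (adjoint i phi).

Lemma istarP phi h : dual_space phi -> ip (istar phi) h = phi (i h).
Proof.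
by move=> dphi; rewrite rieszP//; exact/dual_space_comp/dphi/bounded_linear_embedding.
Qed.

(** If [w] represents [f], then [f (istar phi) = phi (i w)], hence [i w = 0]
    because the dual separates the points of [E]: injectivity of [i] is what
    makes the range of [istar] total. *)
Lemma istar_total f : dual_space (f : H -> R^o) ->
  (forall phi, dual_space phi -> 0 <= f (istar phi)) -> forall h, f h = 0.
Proof.
move=> df f0 h; rewrite -(rieszP ip_norm df) (_ : riesz ip f = 0); last first.
  apply: i_inj; rewrite linear0; apply: dual_separates => phi dphi.
  by rewrite -istarP// ip_sym rieszP// f0.
by rewrite -(scale0r h) ipZl mul0r.
Qed.

Lemma istar_comb (a : R) phi psi : dual_space phi -> dual_space psi ->
  istar (fun x => a *: phi x + psi x) = a *: istar phi + istar psi.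
Proof.
move=> dphi dpsi; apply: ip_inj => h.
by rewrite !ipE !istarP//; exact: dual_space_comb.
Qed.

Lemma istar0 : istar (fun=> 0) = 0.
Proof.
apply: ip_inj => h; rewrite istarP; last exact: dual_space0.
by rewrite -(scale0r h) ipZl mul0r.
Qed.

(** If [h] were at distance at least [e] from the range of [istar], the
    constraints [(t h + istar phi, t e)] would produce a bounded functional that
    vanishes on this range and is at least [e] at [h], against
    [istar_total]. *)
Lemma istar_dense h (e : R) : 0 < e ->
  exists2 phi, dual_space phi & `|h - istar phi| < e.
Proof.
move=> e0; apply: contrapT => far.
have {}far phi : dual_space phi -> e <= `|h - istar phi|.
  by move=> dphi; rewrite leNgt; apply/negP => lt; apply: far; exists phi.
pose C := [set a : H * R | exists t phi,
  [/\ 0 <= t, dual_space phi & a = (t *: h + istar phi, t * e)]].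
have [|||f [lf f1 fC]] := @mazur_orlicz _ _ (fun v : H => 1 * `|v|) C.
- exact: sublinear_norm.
- split.
  + exists 0, (fun=> 0); split=> //; first exact: dual_space0.
    by rewrite istar0 scale0r mul0r addr0.
  + move=> _ _ [s [phi [s0 dphi ->]]] [t [psi [t0 dpsi ->]]] /=.
    exists (s + t), (fun x => 1 *: phi x + psi x); split.
    * exact: addr_ge0.
    * exact: dual_space_comb.
    * by rewrite istar_comb// scale1r scalerDl mulrDl addrACA.
  + move=> s _ s0 [t [phi [t0 dphi ->]]] /=.
    exists (s * t), (fun x => s *: phi x + 0); split.
    * by rewrite mulr_ge0// ltW.
    * exact/dual_space_comb/dual_space0.
    * rewrite istar_comb//; last exact: dual_space0.
      by rewrite istar0 addr0 scalerDr scalerA mulrA.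
- move=> _ [t [phi [t0 dphi ->]]] /=; rewrite mul1r.
  have [->|tn0] := eqVneq t 0; first by rewrite mul0r.
  have {}t0 : 0 < t by rewrite lt_def tn0.
  (* [t h + istar phi] is [t] times [h - istar (- t^-1 phi)]. *)
  have := far (fun x => - t^-1 *: phi x + 0).
  rewrite istar_comb//; last exact: dual_space0.
  rewrite istar0 addr0 scaleNr opprK => /(_ (dual_space_comb _ dphi (dual_space0 _))).
  move=> /(ler_wpM2l (ltW t0))/le_trans; apply.
  rewrite -{1}(gtr0_norm t0) -normrZ scalerDr scalerA mulfV//.
  by rewrite scale1r.
have f0 := istar_total (dominated_dual_space lf f1).
have : C (h, e).
  exists 1, (fun=> 0); split=> //; first exact: dual_space0.
  by rewrite istar0 scale1r mul1r addr0.
move=> /fC/=; rewrite f0; first by rewrite leNgt e0.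
move=> phi dphi; apply: (fC (istar phi, 0)); exists 0, phi; split=> //.
by rewrite scale0r add0r mul0r.
Qed.

(** Under the bound, [istar phi |-> phi x] is a well-defined bounded functional
    on the range of [istar]; the vector [g] that represents an extension of it
    satisfies [phi (i g) = phi x] for every [phi]. *)
Lemma range_criterion (x : E) (c : R) : 0 <= c ->
    (forall phi, dual_space phi -> phi x <= c * `|istar phi|) ->
  exists2 g, i g = x & `|g| <= c.
Proof.
move=> c0 xc.
pose C := [set a : H * R | exists2 phi,
  dual_space phi & a = (istar phi, phi x)].
have [|||f [lf fc fC]] := @mazur_orlicz _ _ (fun v : H => c * `|v|) C.
- exact: sublinear_norm.
- split.
  + by exists (fun=> 0); [exact: dual_space0|rewrite istar0].
  + move=> _ _ [phi dphi ->] [psi dpsi ->] /=.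
    exists (fun x => 1 *: phi x + psi x); first exact: dual_space_comb.
    by rewrite istar_comb// !scale1r.
  + move=> s _ s0 [phi dphi ->] /=.
    exists (fun x => s *: phi x + 0); first exact/dual_space_comb/dual_space0.
    by rewrite istar_comb// ?istar0 ?addr0//; exact: dual_space0.
- by move=> _ [phi dphi ->]; exact: xc.
have df := dominated_dual_space lf fc.
exists (riesz ip f).
  apply/eqP; rewrite -subr_eq0; apply/eqP/dual_separates => phi dphi.
  have -> : phi (i (riesz ip f) - x) = f (istar phi) - phi x.
    rewrite -(rieszP ip_norm df) ip_sym istarP//.
    by rewrite addrC -scaleN1r dphi.1 scaleN1r addrC.
  by rewrite subr_ge0; apply: (fC (istar phi, phi x)); exists phi.
have [->|g0] := eqVneq (riesz ip f) 0; first by rewrite normr0.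
rewrite -(ler_pM2r (x := `|riesz ip f|)) ?normr_gt0//.
by rewrite -expr2 -ip_norm rieszP.
Qed.

End Embedding.

(** * Operators symmetrized by Q *)

(** The ratios [a n.+1 / a n] of a log-convex sequence increase; if the first
    one exceeded [M], the sequence would outgrow every multiple of [M ^+ n]. *)
Lemma log_convex_geometric_bound (R : realType) (a : nat -> R) (K M : R) :
    0 < M -> (forall n, 0 <= a n) ->
    (forall n, a n.+1 ^+ 2 <= a n * a n.+2) ->
    (forall n, a n <= K * M ^+ n) ->
  a 1%N <= M * a 0%N.
Proof.
move=> M0 a_ge0 alc aM; rewrite leNgt; apply/negP => a01.
have a1 : 0 < a 1%N by rewrite (le_lt_trans _ a01)// mulr_ge0// ltW.
have a0 : 0 < a 0%N.
  rewrite lt_def a_ge0 andbT; apply/eqP => a00.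
  by have := alc 0%N; rewrite a00 mul0r leNgt exprn_gt0.
pose r := a 1%N / a 0%N.
have r0 : 0 < r by rewrite divr_gt0.
have step n : 0 < a n /\ r * a n <= a n.+1.
  elim: n => [|n [an0 IH]]; first by rewrite /r divfK ?gt_eqF.
  have an1 : 0 < a n.+1 by rewrite (lt_le_trans _ IH)// mulr_gt0.
  split=> //; rewrite -(ler_pM2l an0) (le_trans _ (alc n))// expr2 mulrA.
  by rewrite ler_pM2r// mulrC.
have grow n : r ^+ n * a 0%N <= a n.
  elim: n => [|n IH]; first by rewrite mul1r.
  by rewrite (le_trans _ (step n).2)// exprS -mulrA ler_pM2l.
have Mr : `|M / r| < 1.
  by rewrite gtr0_norm ?divr_gt0// ltr_pdivrMr// mul1r /r ltr_pdivlMr.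
have : K * (M / r) ^+ n @[n --> \oo] --> K * 0 by apply: cvgMr; exact: cvg_expr.
rewrite mulr0 => /cvgr_lt/(_ _ a0)[N _ /(_ N (leqnn N))/=].
apply/negP; rewrite -leNgt -(ler_pM2l (exprn_gt0 N r0)) (le_trans (grow N))//.
by rewrite (le_trans (aM N))// mulrCA -exprMn mulrC (mulrC r) divfK ?gt_eqF// mulrC.
Qed.

Section Symmetrizable.
Variables (R : realType) (E H : completeNormedModType R).
Variable ip : {dot H for idfun}.
Hypothesis ip_norm : forall h : H, ip h h = `|h| ^+ 2.
Variable i : {linear H -> E}.
Hypotheses (i_cont : continuous i) (i_inj : injective i).
Variables (A : E -> E) (M : R).
Hypotheses (A_bl : bounded_linear A) (M_gt0 : 0 < M).
Hypothesis A_le : forall x, `|A x| <= M * `|x|.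
Hypothesis AQ : forall phi, dual_space phi ->
  A (Qop ip i phi) = Qop ip i (adjoint A phi).

(** This is Lax's argument for symmetrizable operators. Set
    [u n = istar (phi \o A^n)]. As [A] commutes past [Q],
    [ip (u m) (u n) = phi (A^(m + n) (Q phi))] depends on [m + n] only. By
    Cauchy-Schwarz [|u n|] is then log-convex, and its growth is at most that
    of [M ^+ n], so that [|u 1| <= M * |u 0|]. *)
Lemma istar_adjoint_le phi : dual_space phi ->
  `|istar ip i (adjoint A phi)| <= M * `|istar ip i phi|.
Proof.
move=> dphi; pose psi n : E -> R^o := phi \o iter n A.
have dpsi n : dual_space (psi n).
  elim: n => [//|n IH].
  have -> : psi n.+1 = adjoint A (psi n).
    by apply/funext => x; rewrite /psi/= -iterS iterSr.
  exact: dual_space_comp.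
have Qpsi n : Qop ip i (psi n) = iter n A (Qop ip i phi).
  elim: n => [//|n IH]; rewrite iterS -IH AQ//; congr (Qop _ _ _).
  by apply/funext => x; rewrite /psi/= -iterS iterSr.
pose u n := istar ip i (psi n).
have uu m n : ip (u m) (u n) = phi (iter (m + n) A (Qop ip i phi)).
  by rewrite istarP//= /psi/= iterD -Qpsi.
have iter_le n x : `|iter n A x| <= M ^+ n * `|x|.
  elim: n => [|n IH]; first by rewrite mul1r.
  by rewrite iterS exprS -mulrA (le_trans (A_le _))// ler_pM2l.
have [_ [c c0 phic]] := (bounded_linearP _).1 dphi.
pose K := c * `|Qop ip i phi|.
have K0 : 0 <= K by rewrite mulr_ge0 ?(ltW c0).
apply: (@log_convex_geometric_bound _ (fun n => `|u n|) (K + 1)) => //= n.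
- rewrite -ip_norm uu addSn -addnS -uu; exact: ip_le_norm.
(* [|u n|^2 <= K * M^(2n)], and [K <= (K + 1)^2] spares a square root. *)
- rewrite -(@ler_pXn2r _ 2) ?nnegrE ?mulr_ge0 ?addr_ge0 ?exprn_ge0 ?(ltW M_gt0)//.
  have : `|u n| ^+ 2 <= K * M ^+ (n + n).
    rewrite -ip_norm uu (le_trans (ler_norm _))// (le_trans (phic _))//.
    by rewrite /K -mulrA ler_pM2l// mulrC.
  move=> uK; apply: le_trans uK _; rewrite exprD exprMn -expr2.
  rewrite ler_wpM2r ?exprn_ge0 ?(ltW M_gt0)//.
  by have := sqr_ge0 K; rewrite sqrrD; lra.
Qed.

(** [phi (A (i h)) = ip (istar (phi \o A)) h] is at most
    [M * |h| * |istar phi|], which is the bound asked by [range_criterion]. *)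
Lemma symmetrizable_range h : exists2 g, i g = A (i h) & `|g| <= M * `|h|.
Proof.
apply: range_criterion ip_norm _ _ _ _ _ _ => //; first by rewrite mulr_ge0// ltW.
move=> phi dphi.
have dA := dual_space_comp A_bl dphi.
rewrite -[phi _]/(adjoint A phi (i h)) -(istarP ip_norm i_cont)//.
rewrite (le_trans (ip_le_norm ip_norm _ _))// mulrAC ler_wpM2r//.
exact: istar_adjoint_le.
Qed.

End Symmetrizable.

(** * Symmetric semigroups *)

(** Otherwise there are [t n] tending to 0 with the norms of [S (t n)]
    unbounded, although [S (t n) x] converges for every [x]; this contradicts
    the uniform boundedness principle. *)
Lemma C0_semigroup_near0_bounded (R : realType) (V : completeNormedModType R)
    (S : R -> V -> V) : C0_semigroup S ->
  exists2 M, 0 < M & \forall t \near 0^'+, forall x, `|S t x| <= M * `|x|.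
Proof.
move=> [Sbl _ _ Scont]; apply: contrapT => unb.
have /choice[t tP] n : exists t, [/\ 0 < t, t < n.+1%:R^-1 &
    ~ forall x, `|S t x| <= n.+1%:R * `|x|].
  apply: contrapT => nt; apply: unb; exists n.+1%:R => //.
  have n0 : 0 < n.+1%:R^-1 :> R by rewrite invr_gt0.
  apply: filterS2 (nbhs_right_gt 0) (nbhs_right_lt n0) => s s0 sn.
  by apply: contrapT => sP; apply: nt; exists s.
have t_to0 : t n @[n --> \oo] --> 0^'+.
  move=> P [e /= e0 eP]; have := near_infty_natSinv_lt (PosNum e0).
  apply: filterS => n /= ne; have [tn0 tn _] := tP n.
  by apply: eP => //=; rewrite sub0r normrN gtr0_norm// (lt_trans tn).
have /(_ 1)[M MP] : uniform_bounded [set S (t n) | n in setT].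
  apply: Banach_Steinhauss => [_ [n _ <-]|x].
    have [tn0 _ _] := tP n.
    have Sn := Sbl _ (ltW tn0); split; last exact: Sn.1.
    have [_ [c c0 cS]] := (bounded_linearP _).1 Sn.
    by move=> r; exists (c * r) => x xr; rewrite (le_trans (cS x))// ler_pM2l.
  have Sx : S (t n) x @[n --> \oo] --> x by apply: cvg_comp (Scont x).
  have cS : cvgn (fun n => S (t n) x) by apply/cvg_ex; exists x.
  have /ex_bound[|M MS] := cvg_seq_bounded cS.
    exact: (@globally_properfilter _ _ 0%N).
  by exists M => _ [n _ <-]; exact: MS.
have M0 : 0 <= M.
  have := MP _ (ex_intro2 _ _ 0%N I erefl) 0; rewrite normr0 => /(_ ler01).
  exact: le_trans.
have [tn0 _] := tP (Num.bound M); apply => x.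
have [lS _] := Sbl _ (ltW tn0).
pose F : {linear V -> V} := 
  HB.pack (S (t (Num.bound M))) (GRing.isLinear.Build _ _ _ _ _ lS).
have [->|x0] := eqVneq x 0.
  by rewrite (_ : S _ 0 = 0) ?normr0 ?mulr0//; exact: (linear0 F).
have nx0 : 0 < `|x| by rewrite normr_gt0.
have := MP _ (ex_intro2 _ _ (Num.bound M) I erefl) (`|x|^-1 *: x).
rewrite normrZ normfV normr_id mulVf ?gt_eqF// => /(_ (lexx _)).
rewrite (_ : S _ (_ *: x) = `|x|^-1 *: S (t (Num.bound M)) x); last first.
  exact: (linearZ_LR F).
rewrite normrZ normfV normr_id ler_pdivrMl// mulrC => /le_trans; apply.
by rewrite ler_wpM2r// ltW// (lt_trans (archi_boundP M0))// ltr_nat.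
Qed.

Section Restriction.
Variables (R : realType) (E H : completeNormedModType R).
Variable S : R -> E -> E.
Hypothesis S_C0 : C0_semigroup S.
Variable ip : {dot H for idfun}.
Hypothesis ip_norm : forall h : H, ip h h = `|h| ^+ 2.
Variable i : {linear H -> E}.
Hypotheses (i_cont : continuous i) (i_inj : injective i).

Let S_bl t : 0 <= t -> bounded_linear (S t).
Proof. by case: S_C0 => + _ _ _; exact. Qed.

Lemma Q_symmetric_restriction_le (t M : R) :
    Q_symmetric ip i S -> semigroup_invariant i S -> 0 <= t -> 0 < M ->
    (forall x, `|S t x| <= M * `|x|) ->
  forall h, `|restriction i S t h| <= M * `|h|.
Proof.
move=> QS SH t0 M0 SM h.
have [g ig] := symmetrizable_range ip_norm i_cont (S_bl t0) M0 SM (QS t t0) h.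
by move: ig; rewrite -restrictionP// => /i_inj ->.
Qed.

Lemma Q_symmetric_invariant : Q_symmetric ip i S -> semigroup_invariant i S.
Proof.
move=> QS t t0 _ [_ [h _ <-] <-].
have [_ [M M0 SM]] := (bounded_linearP _).1 (S_bl t0).
have [g ig _] := symmetrizable_range ip_norm i_cont (S_bl t0) M0 SM (QS t t0) h.
by exists g.
Qed.

Lemma restriction_linear t :
  semigroup_invariant i S -> 0 <= t -> linear (restriction i S t).
Proof.
move=> SH t0 a u v; apply: i_inj.
by rewrite linearP !restrictionP// linearP (S_bl t0).1.
Qed.

(** The functional [ip (T h) - ip h \o T] is continuous, and at [istar phi] both
    terms equal [phi (S t (i h))] because [T (istar phi) = istar (phi \o S t)].
    The range of [istar] being total, it vanishes. *)
Lemma Q_symmetric_selfadjoint :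
  Q_symmetric ip i S -> selfadjoint_semigroup ip (restriction i S).
Proof.
move=> QS t t0; have SH := Q_symmetric_invariant QS.
have [_ [M M0 SM]] := (bounded_linearP _).1 (S_bl t0).
have Tbl : bounded_linear (restriction i S t).
  apply/bounded_linearP; split; first exact: restriction_linear.
  by exists M => //; exact: Q_symmetric_restriction_le.
split=> // h.
pose f g : R^o := -1 *: ip h (restriction i S t g) + ip (restriction i S t h) g.
have df : dual_space f.
  apply: dual_space_comb (dual_space_ip ip_norm _).
  exact: (dual_space_comp Tbl (dual_space_ip ip_norm h)).
suff f0 g : f g = 0.
  by move=> g; have := f0 g; rewrite /f scaleN1r addrC => /subr0_eq.
apply: (istar_total ip_norm i_cont i_inj df) => phi dphi.
have dS := dual_space_comp (S_bl t0) dphi.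
have -> : f (istar ip i phi) = 0; last by [].
have -> : f (istar ip i phi) = - ip h (restriction i S t (istar ip i phi)) +
    ip (restriction i S t h) (istar ip i phi) by rewrite /f scaleN1r.
have -> : restriction i S t (istar ip i phi) = istar ip i (adjoint (S t) phi).
  by apply: i_inj; rewrite restrictionP// QS.
by rewrite !(ip_sym ip h) (ip_sym ip _ (istar _ _ _)) !istarP// restrictionP// addNr.
Qed.

Lemma selfadjoint_Q_symmetric : semigroup_invariant i S ->
  selfadjoint_semigroup ip (restriction i S) -> Q_symmetric ip i S.
Proof.
move=> SH sa t t0 phi dphi; have dS := dual_space_comp (S_bl t0) dphi.
rewrite -restrictionP//; congr (i _); apply: (ip_inj ip_norm) => h.
by rewrite (sa t t0).2 !(istarP ip_norm i_cont)// restrictionP.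
Qed.

(** Write [T] for the restriction. Since [ip (T t h) (istar phi)] is
    [phi (S t (i h))], the uniform bound on [T t] near 0 and the density of the
    range of [istar] give [ip (T t h) h --> |h|^2]. Selfadjointness turns this
    weak convergence into a strong one, through
    [|T t h - h|^2 = ip (T (2 t) h) h - 2 ip (T t h) h + |h|^2]. *)
Lemma restriction_strongly_continuous : semigroup_invariant i S ->
    selfadjoint_semigroup ip (restriction i S) ->
  forall h, restriction i S t h @[t --> 0^'+] --> h.
Proof.
move=> SH sa h; set T := restriction i S.
have QS := selfadjoint_Q_symmetric SH sa.
have [_ _ SD Scont] := S_C0.
have [M M0 SM] := C0_semigroup_near0_bounded S_C0.
have TM : \forall t \near 0^'+, forall g, `|T t g| <= M * `|g|.
  apply: filterS2 (nbhs_right_gt 0) SM => t t0 SMt g.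
  by apply: Q_symmetric_restriction_le => //; exact: ltW.
have weak : ip (T t h) h @[t --> 0^'+] --> `|h| ^+ 2.
  apply/cvgrPdist_le => e e0.
  (* [b] is a positive bound of [|h - T t h| <= |h| + M * |h|]. *)
  pose b := (M + 1) * (`|h| + 1).
  have b0 : 0 < b by rewrite mulr_gt0// ltr_wpDl// ltW.
  have [phi dphi hphi] := istar_dense ip_norm i_cont i_inj h
    (divr_gt0 (divr_gt0 e0 (ltr0n R 2)) b0).
  have : phi (S t (i h)) @[t --> 0^'+] --> phi (i h).
    by apply: continuous_cvg (Scont _); exact: dphi.2.
  move=> /cvgrPdist_le/(_ _ (divr_gt0 e0 (ltr0n R 2))).
  apply: filterS3 (nbhs_right_gt 0) TM => t t0 TMt phit.
  rewrite -ip_norm.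
  have -> : ip h h - ip (T t h) h =
      (phi (i h) - phi (S t (i h))) + ip (h - T t h) (h - istar ip i phi).
    rewrite -restrictionP ?(ltW t0)// -!(istarP ip_norm i_cont)//.
    rewrite !(ip_sym ip (istar _ _ _)) !linearBr/= !linearBl/=; ring.
  rewrite (le_trans (ler_normD _ _))// [leRHS]splitr lerD//.
  rewrite (le_trans (ip_abs_norm ip_norm _ _))//.
  rewrite -[leRHS](divfK (lt0r_neq0 b0)) mulrC ler_pM//; first exact: ltW.
  rewrite (le_trans (ler_normB _ _))// (le_trans (lerD (lexx _) (TMt h)))//.
  by rewrite /b; have := normr_ge0 h; nra.
have weak2 : ip (T (2 * t) h) h @[t --> 0^'+] --> `|h| ^+ 2.
  apply: cvg_comp weak => P [e /= e0 eP]; exists (e / 2); first exact: divr_gt0.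
  move=> t /=; rewrite sub0r normrN => te t0; apply: eP; rewrite /= ?mulr_gt0//.
  by rewrite sub0r normrN normrM ger0_norm// -ltr_pdivlMl// mulrC.
have sq : `|T t h - h| ^+ 2 @[t --> 0^'+] --> (0 : R).
  have lim0 : ip (T (2 * t) h) h - 2 * ip (T t h) h + `|h| ^+ 2
      @[t --> 0^'+] --> `|h| ^+ 2 - 2 * `|h| ^+ 2 + `|h| ^+ 2.
    by apply: cvgD (cvg_cst _); apply: cvgB weak2 _; exact: cvgMr.
  rewrite (_ : _ + _ = 0) in lim0; last by ring.
  apply: cvg_trans lim0; apply: near_eq_cvg.
  apply: filterS (nbhs_right_gt 0) => t t0.
  have TT : T (2 * t) h = T t (T t h).
    apply: i_inj; rewrite !restrictionP ?mulr_ge0 ?(ltW t0)//.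
    by rewrite mulrDl mul1r SD ?ltW.
  rewrite TT (sa t (ltW t0)).2 -(ip_norm h) -ip_norm.
  rewrite !linearBr/= !linearBl/= (ip_sym ip h (T t h)); ring.
apply/cvgrPdist_lt => e e0.
apply: filterS (cvgr_lt 0 sq (e ^+ 2) (exprn_gt0 2 e0)) => t.
rewrite ltr_pXn2r ?nnegrE ?(ltW e0)//.
by rewrite distrC.
Qed.

Lemma restriction_C0_semigroup : semigroup_invariant i S ->
    selfadjoint_semigroup ip (restriction i S) ->
  C0_semigroup (restriction i S).
Proof.
move=> SH sa; have [_ S0 SD _] := S_C0; split.
- by move=> t t0; exact: (sa t t0).1.
- by move=> h; apply: i_inj; rewrite restrictionP.
- by move=> s t s0 t0 h; apply: i_inj; rewrite !restrictionP ?addr_ge0// SD.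
- exact: restriction_strongly_continuous.
Qed.

End Restriction.

Theorem proposition4p6 (R : realType) (E H : completeNormedModType R)
    (S : R -> E -> E) (S_C0 : C0_semigroup S)
    (ip : {dot H for idfun}) (ip_norm : forall h : H, ip h h = `|h| ^+ 2)
    (i : {linear H -> E}) (i_cont : continuous i) (i_inj : injective i) :
  [<-> Q_symmetric ip i S;
       semigroup_invariant i S /\ selfadjoint_semigroup ip (restriction i S);
       [/\ semigroup_invariant i S,
           selfadjoint_semigroup ip (restriction i S) &
           C0_semigroup (restriction i S)]].
Proof.
tfae.
- by move=> QS; split; [exact: Q_symmetric_invariant QS|exact: Q_symmetric_selfadjoint].
- by move=> [SH sa]; split=> //; exact: restriction_C0_semigroup SH sa.
- by move=> [SH sa _]; exact: selfadjoint_Q_symmetric.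
Qed.
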